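(* Let $G$ be a finite two-generated nilpotent group with direct product decomposition $G\cong\prod_{i=1}^k G_i$, where $G_i$ is the Sylow $p_i$-subgroup of $G$ ($p_1,\dots,p_k$ the distinct primes dividing $|G|$), and let $\pi_i:G\to G_i$ be the natural projections. Then every regular dessin $\mathcal{D}=(G,x,y)$ is (isomorphic to) the parallel product of the regular dessins $\mathcal{D}_i=(G_i,x_i,y_i)$, $i=1,\dots,k$, where $x_i=\pi_i(x)$ and $y_i=\pi_i(y)$. Moreover, for any $\sigma\in\mathrm{Aut}(\Delta)$, $\mathcal{D}$ possesses the external symmetry $\sigma$ if and only if each $\mathcal{D}_i$ $(i=1,\dots,k)$ possesses the external symmetry $\sigma$.
   Context: A regular dessin is a triple $(G,x,y)$ with $G$ a finite group generated by $x,y$; two are isomorphic if $x_1\mapsto x_2$, $y_1\mapsto y_2$ extends to a group isomorphism. The parallel product of dessins $(G_j,x_j,y_j)$, $j=1,\dots,k$, is $(H,x,y)$ with $x=(x_1,\dots,x_k)$, $y=(y_1,\dots,y_k)$ and $H=\langle x,y\rangle\le\prod_j G_j$ (iterating the binary parallel product). Let $\Delta=\langle X,Y\mid -\rangle$ be the free group of rank 2. For $\sigma\in\mathrm{Aut}(\Delta)$ with $\sigma(X)=u(X,Y)$, $\sigma(Y)=v(X,Y)$, a dessin $(G,x,y)$ possesses the external symmetry $\sigma$ if the assignment $x\mapsto u(x,y)$, $y\mapsto v(x,y)$ extends to an automorphism of $G$. *)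

(* Defs.v *)
From HB Require Import structures.
From mathcomp Require Import all_boot all_fingroup all_solvable.

Set Implicit Arguments.
Unset Strict Implicit.
Unset Printing Implicit Defensive.

Import GroupScope.

(* The free group Delta = < X, Y | - >, realised as the reduced words in the   *)
(* letters X, Y, X^-1, Y^-1. A letter is a pair (generator, inverted?), where  *)
(* the generator false stands for X and true for Y.                            *)

Definition letter : Type := (bool * bool)%type.

Definition linv (l : letter) : letter := (l.1, ~~ l.2).

Definition reduced (w : seq letter) : bool :=
  sorted (fun l m : letter => m != linv l) w.

Definition push (l : letter) (w : seq letter) : seq letter :=
  if w is m :: w' then if m == linv l then w' else l :: w else [:: l].

Definition reduce (w : seq letter) : seq letter := foldr push [::] w.

Lemma linvK : involutive linv.
Proof. by case=> a b; rewrite /linv /= negbK. Qed.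

Lemma reduced_push l w : reduced w -> reduced (push l w).
Proof.
case: w => //= m w pw; case: ifP => [_|/negbT ml] /=; last by rewrite ml.
exact: path_sorted pw.
Qed.

Lemma reduced_foldr_push u w : reduced w -> reduced (foldr push w u).
Proof. by move=> rw; elim: u => //= l u; exact: reduced_push. Qed.

Lemma reduced_reduce w : reduced (reduce w).
Proof. exact: reduced_foldr_push. Qed.

Lemma reduce_id w : reduced w -> reduce w = w.
Proof.
elim: w => //= l w IHw pw; rewrite (IHw (path_sorted pw)).
by case: w pw {IHw} => //= m w /andP[/negPf-> _].
Qed.

Lemma pushK l w : reduced w -> push l (push (linv l) w) = w.
Proof.
case: w => [|m w] /=; first by rewrite eqxx.
rewrite linvK; case: (altP (m =P l)) => [->|_ _] /=; last by rewrite eqxx.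
by case: w => [|n w] //= /andP[/negPf-> _].
Qed.

Lemma foldr_push_push l u w : reduced w ->
  foldr push w (push l u) = push l (foldr push w u).
Proof.
move=> rw; case: u => [|m u] //=; case: ifP => //= /eqP->.
by rewrite pushK // reduced_foldr_push.
Qed.

Lemma foldr_push_reduce u w : reduced w ->
  foldr push w (reduce u) = foldr push w u.
Proof. by move=> rw; elim: u => //= l u IHu; rewrite foldr_push_push // IHu. Qed.

Lemma reduce_cat u v : reduce (u ++ v) = foldr push (reduce v) u.
Proof. by rewrite /reduce foldr_cat. Qed.

Lemma reduce_catl u v : reduce (reduce u ++ v) = reduce (u ++ v).
Proof. by rewrite !reduce_cat foldr_push_reduce ?reduced_reduce. Qed.

Lemma reduce_catr u v : reduce (u ++ reduce v) = reduce (u ++ v).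
Proof. by rewrite !reduce_cat (reduce_id (reduced_reduce v)). Qed.

Definition winv (w : seq letter) : seq letter := rev (map linv w).

Lemma winvK : involutive winv.
Proof. by move=> w; rewrite /winv map_rev revK (mapK linvK). Qed.

Lemma reduced_winv w : reduced w -> reduced (winv w).
Proof.
rewrite /reduced /winv rev_sorted sorted_map.
apply: sub_sorted => l m /=; apply: contraNN => /eqP; rewrite linvK => ->.
by rewrite eqxx.
Qed.

Lemma reduce_catV w : reduce (w ++ winv w) = [::].
Proof.
elim: w => //= l w IHw; rewrite /winv /= rev_cons -cats1 catA -/(winv w).
by rewrite -reduce_catl IHw /= eqxx.
Qed.

Lemma reduce_Vcat w : reduce (winv w ++ w) = [::].
Proof. by rewrite -{2}[w]winvK reduce_catV. Qed.

Record Delta : Type := MkDelta { dword :> seq letter; _ : reduced dword }.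

HB.instance Definition _ := [isSub for dword].
HB.instance Definition _ := [Choice of Delta by <:].

Lemma reduced_dword (u : Delta) : reduced u.
Proof. by case: u. Qed.

Definition Delta_one : Delta := @MkDelta [::] isT.
Definition Delta_mul (u v : Delta) : Delta := MkDelta (reduced_reduce (u ++ v)).
Definition Delta_inv (u : Delta) : Delta :=
  MkDelta (reduced_winv (reduced_dword u)).

Lemma Delta_mulA : associative Delta_mul.
Proof.
by move=> u v w; apply: val_inj; rewrite /= reduce_catl reduce_catr catA.
Qed.

Lemma Delta_mul1 : left_id Delta_one Delta_mul.
Proof. by move=> u; apply: val_inj; exact/reduce_id/reduced_dword. Qed.

Lemma Delta_mulr1 : right_id Delta_one Delta_mul.
Proof.
by move=> u; apply: val_inj; rewrite /= cats0; exact/reduce_id/reduced_dword.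
Qed.

Lemma Delta_mulV : left_inverse Delta_one Delta_inv Delta_mul.
Proof. by move=> u; apply: val_inj; exact: reduce_Vcat. Qed.

Lemma Delta_mulrV : right_inverse Delta_one Delta_inv Delta_mul.
Proof. by move=> u; apply: val_inj; exact: reduce_catV. Qed.

HB.instance Definition _ := isGroup.Build Delta
  Delta_mulA Delta_mul1 Delta_mulr1 Delta_mulV Delta_mulrV.

Definition DX : Delta := @MkDelta [:: (false, false)] isT.
Definition DY : Delta := @MkDelta [:: (true, false)] isT.

(* For u = u(X, Y) in Delta, [ev x y u] is the value u(x, y).                  *)

Definition lev (gT : groupType) (x y : gT) (l : letter) : gT :=
  let g := if l.1 then y else x in if l.2 then g^-1 else g.

Definition ev (gT : groupType) (x y : gT) (u : Delta) : gT :=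
  \prod_(l <- dword u) lev x y l.

(* (Delta, DX, DY) has the universal property of the free group: [ev x y] is   *)
(* the unique group morphism sending DX to x and DY to y.                      *)

Lemma evX (gT : groupType) (x y : gT) : ev x y DX = x.
Proof. by rewrite /ev big_seq1. Qed.

Lemma evY (gT : groupType) (x y : gT) : ev x y DY = y.
Proof. by rewrite /ev big_seq1. Qed.

Lemma lev_linv (gT : groupType) (x y : gT) l : lev x y (linv l) = (lev x y l)^-1.
Proof. by case: l => -[] []; rewrite /lev //= invgK. Qed.

Lemma lev_reduce (gT : groupType) (x y : gT) w :
  \prod_(l <- reduce w) lev x y l = \prod_(l <- w) lev x y l.
Proof.
elim: w => //= l w IHw; rewrite big_cons -IHw.
case: (reduce w) => [|m v] /=; first by rewrite big_seq1 big_nil mulg1.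
case: ifP => [/eqP->|_]; last by rewrite big_cons.
by rewrite big_cons lev_linv mulKVg.
Qed.

Lemma evM (gT : groupType) (x y : gT) : {morph ev x y : u v / u * v}.
Proof. by move=> u v; rewrite /ev /= lev_reduce big_cat. Qed.

Lemma ev_unique (gT : groupType) (x y : gT) (f : Delta -> gT) :
  {morph f : u v / u * v} -> f DX = x -> f DY = y -> f =1 ev x y.
Proof.
move=> fM fX fY.
have f1 : f 1 = 1 by apply: (mulgI (f 1)); rewrite -fM !mulg1.
have fV u : f u^-1 = (f u)^-1.
  by apply: (mulgI (f u)); rewrite -fM !mulgV.
have fl l (rl : reduced [:: l]) : f (MkDelta rl) = lev x y l.
  case: l rl => -[] [] rl; rewrite /lev /=.
  - by rewrite -fY -fV; congr f; apply: val_inj.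
  - by rewrite -fY; congr f; apply: val_inj.
  - by rewrite -fX -fV; congr f; apply: val_inj.
  - by rewrite -fX; congr f; apply: val_inj.
case=> w; elim: w => [|l w IHw] rw.
  by rewrite /ev big_nil -f1; congr f; apply: val_inj.
have rw' : reduced w := path_sorted rw.
have rl : reduced [:: l] by [].
have -> : MkDelta rw = MkDelta rl * MkDelta rw'.
  by apply: val_inj; rewrite /= -[push l _]/(reduce (l :: w)) reduce_id.
by rewrite fM evM fl IHw /ev big_seq1.
Qed.

(* A candidate dessin (G, x, y); it is a regular dessin when x, y generate G.  *)

Record dessin : Type := Dessin {
  dtype : finGroupType;
  dgroup : {group dtype};
  dx : dtype;
  dy : dtype
}.

Definition is_regular_dessin (D : dessin) : Prop :=
  dgroup D = <<[set dx D; dy D]>>%G.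

Definition dessin_isomorphic (D1 D2 : dessin) : Prop :=
  exists f : {morphism dgroup D1 >-> dtype D2},
    [/\ isom (dgroup D1) (dgroup D2) f, f (dx D1) = dx D2 & f (dy D1) = dy D2].

Definition parallel_product (I : finType) (D : I -> dessin) : dessin :=
  let x : {dffun forall i, dtype (D i)} := [ffun i => dx (D i)] in
  let y : {dffun forall i, dtype (D i)} := [ffun i => dy (D i)] in
  @Dessin {dffun forall i, dtype (D i)} <<[set x; y]>>%G x y.

(* [Aut G] consists of the permutations of the ambient type that fix the       *)
(* complement of G and restrict to automorphisms of G.                         *)

Definition external_symmetry (D : dessin) (sigma : Delta -> Delta) : Prop :=
  exists2 a : {perm dtype D}, a \in Aut (dgroup D) &
    a (dx D) = ev (dx D) (dy D) (sigma DX) /\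
    a (dy D) = ev (dx D) (dy D) (sigma DY).

(* Natural projection onto the i-th factor of an internal direct product of    *)
(* the groups Gs: g is decomposed as \prod_j z j with z j in Gs j, and sent to *)
(* z i. The default value 1 is only used when there is no such decomposition.  *)

Definition dprod_proj (gT : finGroupType) (k : nat) (Gs : 'I_k -> {group gT})
    (i : 'I_k) (g : gT) : gT :=
  if [pick z : {ffun 'I_k -> gT} |
        [forall j, z j \in Gs j] && (\prod_j z j == g)] is Some z
  then z i else 1.

Lemma dprod_projP (gT : finGroupType) (k : nat) (Gs : 'I_k -> {group gT})
    (G : {group gT}) (z : 'I_k -> gT) (i : 'I_k) :
  \big[dprod/1]_j Gs j = G -> (forall j, z j \in Gs j) ->
  dprod_proj Gs i (\prod_j z j) = z i.
Proof.
move=> dG zG; rewrite /dprod_proj; case: pickP => [t|/(_ (finfun z))]; last first.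
  have -> : [forall j, finfun z j \in Gs j].
    by apply/forallP => j; rewrite ffunE.
  by under eq_bigr do rewrite ffunE; rewrite eqxx.
case/andP=> /forallP tG /eqP e.
have gG : \prod_j z j \in G by rewrite -(bigdprodW dG) mem_prodg.
have [c [_ _ uc]] := mem_bigdprod dG gG.
by rewrite (uc t (fun j _ => tG j) (esym e) i) // (uc z (fun j _ => zG j)).
Qed.

(* Main.v *)
Require Import Defs.
From HB Require Import structures.
From mathcomp Require Import all_boot all_fingroup all_solvable.

Set Implicit Arguments.
Unset Strict Implicit.
Unset Printing Implicit Defensive.

Import GroupScope.

(** A finite nilpotent group is the internal direct product of its Sylow
    subgroups, so the projections [pi_i] are morphisms, and they commute with
    evaluation of words of the free group. Since [G] is generated by [x] and [y],
    applying [pi_i] gives generators of [G_i], and the map [g |-> (pi_i g)_i] is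
    an isomorphism onto the group generated by the images of [x] and [y]. The
    Sylow subgroups are characteristic, so an automorphism of [G] restricts to
    each of them and commutes with the [pi_i]; conversely, automorphisms [a_i] of
    the factors glue to [g |-> \prod_i a_i (pi_i g)]. *)

(** As [r] has no repetition, every later index [j] differs from [i], so [t i] can be moved past the
    product of the later [z j]. *)
Lemma big_prodgM_commute (gT : groupType) (I : eqType) (r : seq I)
    (z t : I -> gT) :
  uniq r -> (forall i j, i != j -> commute (z i) (t j)) ->
  \prod_(i <- r) (z i * t i) = \prod_(i <- r) z i * \prod_(i <- r) t i.
Proof.
move=> + czt; elim: r => [|i r IHr] /=; first by rewrite !big_nil mulg1.
case/andP=> ir ur; rewrite !big_cons IHr // -!mulgA; congr (_ * _).
rewrite !mulgA; congr (_ * _); rewrite big_seq.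
elim/big_ind: _ => [|u v cu cv|j jr]; first by rewrite mulg1 mul1g.
  by rewrite mulgA cu -mulgA cv mulgA.
by apply/esym/czt; apply: contraNneq ir => <-.
Qed.

(** Splitting off [H i] leaves a complement that centralises it and contains [H j]. *)
Lemma bigdprod_commute (gT : finGroupType) (I : finType)
    (H : I -> {group gT}) (G : {group gT}) i j u v :
  \big[dprod/1]_i H i = G -> i != j -> u \in H i -> v \in H j -> commute u v.
Proof.
rewrite (bigD1 i) //= => dG nij Hu Hv.
have [[_ K _ dK] _ cHK _] := dprodP dG.
apply/commute_sym/(centsP cHK) => //; rewrite dK.
move: dK; rewrite (bigD1 j) 1?eq_sym //= => dK.
by have [[_ L _ ->] <- _ _] := dprodP dK; apply: (subsetP (mulG_subl L _)).
Qed.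

(** Since [f] is multiplicative on [G] only, all letters must be seen to lie in [G] before [f] is
    pushed through the word. With [f] the identity, the first half places word values in [G]. *)
Lemma ev_morphism (aT rT : finGroupType) (G : {group aT}) (f : aT -> rT) x y :
  {in G &, {morph f : g h / g * h}} -> x \in G -> y \in G ->
  forall u, ev x y u \in G /\ f (ev x y u) = ev (f x) (f y) u.
Proof.
move=> fM Gx Gy u; pose F := Morphism fM; rewrite -[f]/(F : _ -> _) /ev.
have Gl l : lev x y l \in G by case: l => -[] []; rewrite /lev /= ?groupV.
split; first by rewrite group_prod.
rewrite morph_prod //; apply: eq_bigr => l _.
by case: l => -[] [] //; rewrite /lev /= -[f]/(F : _ -> _) morphV.
Qed.

Lemma morphim_gen2 (aT rT : finGroupType) (G : {group aT})
    (f : {morphism G >-> rT}) x y :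
  G :=: <<[set x; y]>> -> f @* G = <<[set f x; f y]>>.
Proof.
move=> dG.
have sxy : [set x; y] \subset G by rewrite dG subset_gen.
rewrite (congr1 (fun A => f @* A) dG) morphim_gen // morphimEsub //.
by rewrite imsetU !imset_set1.
Qed.

(** [Aut G] asks for a permutation of the whole type, while [f] is controlled on [G] alone. By
    finiteness the injective endomorphism [f] maps [G] onto [G], so [aut] turns it into such a
    permutation. *)
Lemma Aut_extend (gT : finGroupType) (G : {group gT}) (f : gT -> gT) :
  {in G &, {morph f : g h / g * h}} -> {in G &, injective f} ->
  {in G, forall g, f g \in G} ->
  exists2 a : {perm gT}, a \in Aut G & {in G, a =1 f}.
Proof.
move=> fM fI fG; pose F := Morphism fM.
have injF : 'injm F by apply/injmP.
have imF : F @* G = G.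
  apply/morphim_fixP => //; apply/subsetP => _ /morphimP[g _ Gg ->].
  exact: fG.
by exists (aut injF imF); [apply: Aut_aut | apply: autE].
Qed.

Section DirectProductProjection.

Variables (gT : finGroupType) (k : nat) (Gs : 'I_k -> {group gT}).
Variable G : {group gT}.
Hypothesis dG : \big[dprod/1]_j Gs j = G.

Local Notation pr := (dprod_proj Gs).

Lemma dprod_proj_factor i g : g \in G -> pr i g \in Gs i.
Proof.
move=> Gg; have [c [cG -> _]] := mem_bigdprod dG Gg.
by rewrite (dprod_projP i dG) => [|j]; apply: cG.
Qed.

Lemma prod_dprod_proj g : g \in G -> \prod_j pr j g = g.
Proof.
move=> Gg; have [c [cG -> _]] := mem_bigdprod dG Gg.
by apply: eq_bigr => j _; apply: dprod_projP dG _ => i; apply: cG.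
Qed.

Lemma mem_prod_factors (z : 'I_k -> gT) :
  (forall j, z j \in Gs j) -> \prod_j z j \in G.
Proof. by move=> zG; rewrite -(bigdprodW dG) mem_prodg. Qed.

Lemma prod_factorsM (z t : 'I_k -> gT) :
  (forall j, z j \in Gs j) -> (forall j, t j \in Gs j) ->
  \prod_j (z j * t j) = \prod_j z j * \prod_j t j.
Proof.
move=> zG tG; apply: big_prodgM_commute (index_enum_uniq _) _ => i j nij.
exact: bigdprod_commute dG nij (zG i) (tG j).
Qed.

(** Distinct factors commute, so multiplying the decompositions of [g] and [h] componentwise
    decomposes [g * h]; uniqueness does the rest. *)
Lemma dprod_projM i : {in G &, {morph pr i : g h / g * h}}.
Proof.
move=> g h Gg Gh; rewrite -{1}(prod_dprod_proj Gg) -{1}(prod_dprod_proj Gh).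
rewrite -prod_factorsM => [|j|j]; [|exact: dprod_proj_factor..].
by rewrite (dprod_projP i dG) // => j; rewrite groupM // dprod_proj_factor.
Qed.

Lemma factor_sub i : Gs i \subset G.
Proof.
move: dG; rewrite (bigD1 i) //= => dGi.
by have [[_ K _ ->] <- _ _] := dprodP dGi; apply: mulG_subl.
Qed.

Lemma dprod_proj_id i g : g \in Gs i -> pr i g = g.
Proof.
(* The decomposition of [g] has [g] at [i] and 1 elsewhere. *)
move=> Gg; pose z j := if j == i then g else 1.
have zG j : z j \in Gs j by rewrite /z; case: eqP => [->|].
have {1}<- : \prod_j z j = g.
  by rewrite -big_mkcond big_pred1_eq.
by rewrite (dprod_projP i dG) // /z eqxx.
Qed.

Lemma dprod_proj_inj g h :
  g \in G -> h \in G -> (forall i, pr i g = pr i h) -> g = h.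
Proof.
move=> Gg Gh eq_gh; rewrite -(prod_dprod_proj Gg) -(prod_dprod_proj Gh).
by apply: eq_bigr => i _.
Qed.

Lemma im_dprod_proj i : Morphism (dprod_projM i) @* G = Gs i.
Proof.
apply/eqP; rewrite eqEsubset; apply/andP; split; apply/subsetP => g.
  by case/morphimP => h _ Gh ->; apply: dprod_proj_factor.
move=> Gg; apply/morphimP; have Gg' := subsetP (factor_sub i) g Gg.
by exists g => //=; rewrite dprod_proj_id.
Qed.

Lemma regular_dprod_proj i x y :
  G :=: <<[set x; y]>> -> Gs i :=: <<[set pr i x; pr i y]>>.
Proof. by move=> Gxy; rewrite -im_dprod_proj (morphim_gen2 _ Gxy). Qed.

Lemma dessin_isomorphic_parallel_product x y :
  G :=: <<[set x; y]>> ->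
  dessin_isomorphic (Dessin G x y)
    (parallel_product (fun i => Dessin (Gs i) (pr i x) (pr i y))).
Proof.
move=> Gxy.
pose f g : {dffun forall i : 'I_k, gT} := [ffun i => pr i g].
have fM : {in G &, {morph f : g h / g * h}}.
  by move=> g h Gg Gh; apply/ffunP => i; rewrite !ffunE dprod_projM.
(* The image of [f] is generated by [f x] and [f y], which are by definition the generators of the
   parallel product. *)
exists (Morphism fM); split=> //; apply/isomP; split; last exact: morphim_gen2.
apply/injmP => g h Gg Gh /ffunP eq_gh; apply: dprod_proj_inj => // i.
by have := eq_gh i; rewrite !ffunE.
Qed.

(** As [a] preserves every factor, applying it to the decomposition of [g] yields the decomposition
    of [a g]. *)
Lemma Aut_dprod_proj a i g :
  (forall j, Gs j \char G) -> a \in Aut G -> g \in G ->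
  pr i (a g) = a (pr i g).
Proof.
move=> charGs Aa Gg.
have aGs j : a (pr j g) \in Gs j.
  have /charP[sGj /(_ _ (injm_autm Aa) (im_autm Aa)) im] := charGs j.
  rewrite -im -(autmE Aa) mem_morphim ?(subsetP sGj) //;
    exact: dprod_proj_factor.
rewrite -{1}(prod_dprod_proj Gg) -(autmE Aa) morph_prod => [|j _].
  by rewrite (dprod_projP i dG).
by rewrite (subsetP (factor_sub j)) // dprod_proj_factor.
Qed.

Lemma external_symmetry_dprod x y (sigma : Delta -> Delta) :
  (forall j, Gs j \char G) -> x \in G -> y \in G ->
  external_symmetry (Dessin G x y) sigma <->
  forall i, external_symmetry (Dessin (Gs i) (pr i x) (pr i y)) sigma.
Proof.
move=> charGs Gx Gy; have evG i := ev_morphism (dprod_projM i) Gx Gy.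
split=> [[a /= Aa [ax ay]] i | symGs].
  have sGi := subsetP (factor_sub i).
  have aM := morphM (autm_morphism Aa).
  (* The permutation [a] may move points outside [Gs i], so it is replaced by some [b] in
     [Aut (Gs i)] agreeing with it on [Gs i]. *)
  have [|||b Ab ab] := @Aut_extend _ (Gs i) a.
  - by move=> g h Gg Gh; apply: aM; apply: sGi.
  - by move=> g h _ _; apply: perm_inj.
  - move=> g Gg; rewrite -(dprod_proj_id Gg) -Aut_dprod_proj ?sGi //.
    by rewrite dprod_proj_factor // Aut_closed // sGi.
  exists b => //=; rewrite !ab ?dprod_proj_factor //.
  by rewrite -!Aut_dprod_proj // ax ay; split; apply: (evG i _).2.
have {symGs} [a aP] : exists a : 'I_k -> {perm gT}, forall i,
    [/\ a i \in Aut (Gs i),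
        a i (pr i x) = ev (pr i x) (pr i y) (sigma DX) &
        a i (pr i y) = ev (pr i x) (pr i y) (sigma DY)].
  apply: (fin_all_exists (P := fun i b => [/\ b \in Aut (Gs i),
        b (pr i x) = ev (pr i x) (pr i y) (sigma DX) &
        b (pr i y) = ev (pr i x) (pr i y) (sigma DY)])) => i.
  by have [b Ab [bx bY]] := symGs i; exists b.
have Aa i : a i \in Aut (Gs i) by have [] := aP i.
have aG i g : g \in G -> a i (pr i g) \in Gs i.
  by move=> Gg; rewrite Aut_closed // dprod_proj_factor.
pose f g := \prod_i a i (pr i g).
(* The components of [f g] are the [a i (pr i g)], which makes [f] multiplicative and injective. *)
have prf i g : g \in G -> pr i (f g) = a i (pr i g).
  by move=> Gg; rewrite (dprod_projP i dG) // => j; apply: aG.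
have [|||b Ab bf] := @Aut_extend _ G f.
- move=> g h Gg Gh; rewrite /f -prod_factorsM => [|j|j]; [|exact: aG..].
  apply: eq_bigr => j _; rewrite dprod_projM //.
  by apply: (morphM (autm_morphism (Aa j))); apply: dprod_proj_factor.
- move=> g h Gg Gh eq_f; apply: dprod_proj_inj => // i.
  by apply: (@perm_inj _ (a i)); rewrite -!prf // eq_f.
- by move=> g Gg; apply: mem_prod_factors => j; apply: aG.
(* Equality with a word value is tested on components, where [pr i] passes through the word; this
   serves both generators. *)
have fev u v : u \in G -> (forall i, a i (pr i u) = ev (pr i x) (pr i y) v) ->
    b u = ev x y v.
  move=> Gu auv; apply: dprod_proj_inj => [||i]; first exact: Aut_closed.
    have idM : {in G &, {morph id : g h / g * h}} by [].
    exact: (ev_morphism idM Gx Gy v).1.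
  by rewrite bf // prf // (evG i v).2.
by exists b => //=; split; apply: fev => // i; have [] := aP i.
Qed.

End DirectProductProjection.

(** A nilpotent group equals its Fitting subgroup, defined as the direct product of the [q]-cores
    over the primes [q] dividing its order. It remains to reindex by [p] and identify each core with
    a Sylow subgroup. *)
Lemma nilpotent_bigdprod_Sylow (gT : finGroupType) (G : {group gT}) (k : nat)
    (p : 'I_k -> nat) (Gs : 'I_k -> {group gT}) :
  nilpotent G -> injective p ->
  (forall q, (q \in primes #|G|) = (q \in codom p)) ->
  (forall i, (p i).-Sylow(G) (Gs i)) ->
  \big[dprod/1]_i Gs i = G.
Proof.
move=> nilG p_inj p_primes sylGs.
rewrite -[RHS](nilpotent_Fitting nilG) /Fitting.
have eq_p : perm_eq (primes #|G|) (codom p).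
  by rewrite uniq_perm ?primes_uniq //; apply/injectiveP.
rewrite (perm_big _ eq_p) /= /codom /image_mem big_map big_enum /=.
by apply: eq_bigr => i _; apply: nilpotent_Hall_pcore.
Qed.

Theorem theorem3p9 (gT : finGroupType) (G : {group gT})
    (nilG : nilpotent G)
    (k : nat) (p : 'I_k -> nat) (p_inj : injective p)
    (p_primes : forall q : nat, (q \in primes #|G|) = (q \in codom p))
    (Gs : 'I_k -> {group gT})
    (sylGs : forall i : 'I_k, (p i).-Sylow(G) (Gs i))
    (x y : gT) :
  let D := Dessin G x y in
  let Ds := fun i : 'I_k =>
    Dessin (Gs i) (dprod_proj Gs i x) (dprod_proj Gs i y) in
  is_regular_dessin D ->
  [/\ forall i : 'I_k, is_regular_dessin (Ds i),
      dessin_isomorphic D (parallel_product Ds) &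
      forall sigma : {multiplicative Delta -> Delta}, bijective sigma ->
        (external_symmetry D sigma <->
         forall i : 'I_k, external_symmetry (Ds i) sigma)].
Proof.
move=> D Ds /(congr1 val) /= Gxy.
have dG := nilpotent_bigdprod_Sylow nilG p_inj p_primes sylGs.
have Gx : x \in G by rewrite Gxy mem_gen // !inE eqxx.
have Gy : y \in G by rewrite Gxy mem_gen // !inE eqxx orbT.
split=> [i||sigma _].
- exact: val_inj (regular_dprod_proj dG i Gxy).
- exact: dessin_isomorphic_parallel_product.
apply: external_symmetry_dprod => // j.
(* By nilpotency [Gs j] is the [p j]-core of [G], hence characteristic. *)
by rewrite (nilpotent_Hall_pcore nilG (sylGs j)) pcore_char.
Qed.
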